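(* Let $\Lambda\subset(0,\infty)$ be finite or countable and let $X,Y\subset\mathbb U_\Lambda$ be nonempty finite subsets. The map assigning to $g\in\mathbb I_\Lambda$ the morphism $(Y\cup g(X),\,g|_X,\,\mathrm{id}_Y)\in\mathrm{Mor}(X,Y)$ (where $\mathrm{id}_Y$ denotes the inclusion $Y\hookrightarrow Y\cup g(X)$) induces a one-to-one correspondence between double cosets $\mathbb I[Y]\backslash\mathbb I_\Lambda/\mathbb I[X]$ and elements of $\mathrm{Mor}(X,Y)$.
   Context: An ultrametric space is a metric space with $d(x,z)\le\max(d(x,y),d(y,z))$; its spectrum is its set of nonzero distances. $\mathbb U_\Lambda$ is the ultrametric Urysohn space: the unique (up to isometry) complete separable ultrametric space with spectrum $\Lambda$ such that for any finite ultrametric spaces $X\subset Y$ with spectra in $\Lambda$, each isometric embedding $X\to\mathbb U_\Lambda$ extends to an isometric embedding $Y\to\mathbb U_\Lambda$. (Model: functions $\omega:\Lambda\to\mathbb Z$ whose support is finite or a sequence converging to $0$, with $d(\omega,\omega')=\max\{\lambda:\omega(\lambda)\ne\omega'(\lambda)\}$ for $\omega\ne\omega'$.) $\mathbb I_\Lambda$ is the group of all bijective isometries of $\mathbb U_\Lambda$, acting on the left; $\mathbb I[X]$ is the pointwise stabilizer of $X$ in $\mathbb I_\Lambda$. $\mathrm{Mor}(X,Y)$ is the set of triples $(P,p_+,p_-)$, where $P$ is an ultrametric space with spectrum in $\Lambda$, and $p_+:X\to P$, $p_-:Y\to P$ are isometric embeddings with $p_+(X)\cup p_-(Y)=P$;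 two triples $(P,p_\pm)$, $(P',p'_\pm)$ are regarded as equal if there is a bijective isometry $\pi:P\to P'$ with $p'_\pm=\pi\circ p_\pm$. *)

(* Defs.v *)
From HB Require Import structures.
From mathcomp Require Import all_boot all_order all_algebra.
From mathcomp Require Import all_classical all_reals topology.

Set Implicit Arguments.
Unset Strict Implicit.
Unset Printing Implicit Defensive.

Import Order.TTheory GRing.Theory Num.Theory.

Local Open Scope classical_set_scope.
Local Open Scope ring_scope.

Section SubMetric.
Context (R : realType) (T : metricType R) (A : set T).

Let dist (x y : A) : R := mdist (val x) (val y).

Let dist_ge0 (x y : A) : 0 <= dist x y.
Proof. exact: mdist_ge0. Qed.

Let dist_positivity (x y : A) : dist x y = 0 -> x = y.
Proof. by move/mdist_positivity/val_inj. Qed.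

Let ballEdist (x : A) (e : R) : ball x e = [set y | dist x y < e].
Proof. by rewrite /ball /= /initial_ball /= ballEmdist. Qed.

(* The subspace metric on a subset; mathcomp-analysis only provides the induced
   pseudometric structure. *)
HB.instance Definition _ :=
  @PseudoMetric_isMetric.Build R (A : Type) dist dist_ge0 dist_positivity
    ballEdist.

End SubMetric.

Section MetricNotions.
Context (R : realType).
Implicit Types (T : metricType R) (Lambda : set R).

Definition ultrametric T : Prop :=
  forall x y z : T, mdist x z <= Num.max (mdist x y) (mdist y z).

Definition spectrum T : set R :=
  [set r | r != 0 /\ exists x y : T, r = mdist x y].

Definition isometric (T1 T2 : metricType R) (f : T1 -> T2) : Prop :=
  forall x y, mdist (f x) (f y) = mdist x y.

Definition complete T : Prop :=
  forall F : set_system T, ProperFilter F -> cauchy F ->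
    exists x : T, F --> x.

Definition separable T : Prop := exists2 D : set T, countable D & dense D.

(* In the extension property, the embedding is defined on the subset B only
   and B may be empty; in particular this forces U to be nonempty. *)
Record is_urysohn Lambda (U : metricType R) : Prop := IsUrysohn {
  urysohn_ultrametric : ultrametric U ;
  urysohn_complete : complete U ;
  urysohn_separable : separable U ;
  urysohn_spectrum : spectrum U = Lambda ;
  urysohn_extension : forall (C : metricType R) (B : set C) (f : B -> U),
    finite_set [set: C] -> ultrametric C -> spectrum C `<=` Lambda ->
    isometric f ->
    exists2 h : C -> U, isometric h & forall x : B, h (val x) = f x
}.

End MetricNotions.

Section IsometryGroup.
Context (R : realType) (U : metricType R).

Record isom := Isom {
  isom_fun :> U -> U ;
  isom_isometric : isometric isom_fun ;
  isom_bijective : bijective isom_fun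
}.

HB.instance Definition _ := gen_eqMixin isom.
HB.instance Definition _ := gen_choiceMixin isom.

Lemma isomP (g h : isom) : g =1 h -> g = h.
Proof.
case: g h => [g gi gb] [h hi hb] /= /funext gh; rewrite gh in gi gb *.
by congr Isom; exact: Prop_irrelevance.
Qed.

Definition isom_one : isom.
Proof. by exists id => //; exists id. Defined.

Definition isom_mul (g h : isom) : isom.
Proof.
exists (g \o h) => [x y|]; first by rewrite /= !isom_isometric.
exact: bij_comp (isom_bijective g) (isom_bijective h).
Defined.

Definition isom_inv_fun (g : isom) : U -> U :=
  sval (cid2 (let: Bijective g' gK g'K := isom_bijective g in
              ex_intro2 _ _ g' gK g'K)).

Lemma isom_funK (g : isom) : cancel g (isom_inv_fun g).
Proof. by rewrite /isom_inv_fun; case: cid2. Qed.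

Lemma isom_inv_funK (g : isom) : cancel (isom_inv_fun g) g.
Proof. by rewrite /isom_inv_fun; case: cid2. Qed.

Definition isom_inv (g : isom) : isom.
Proof.
exists (isom_inv_fun g) => [x y|].
  by rewrite -(isom_isometric g) !isom_inv_funK.
exact: Bijective (isom_inv_funK g) (isom_funK g).
Defined.

Lemma isom_mulA : associative isom_mul.
Proof. by move=> f g h; apply: isomP. Qed.
Lemma isom_mul1 : left_id isom_one isom_mul.
Proof. by move=> g; apply: isomP. Qed.
Lemma isom_mulr1 : right_id isom_one isom_mul.
Proof. by move=> g; apply: isomP. Qed.
Lemma isom_mulV : left_inverse isom_one isom_inv isom_mul.
Proof. by move=> g; apply: isomP => x; exact: isom_funK. Qed.
Lemma isom_mulrV : right_inverse isom_one isom_inv isom_mul.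
Proof. by move=> g; apply: isomP => x; exact: isom_inv_funK. Qed.

(* The product is composition, (g * h) x = g (h x), so that isom acts on U on
   the left. *)
HB.instance Definition _ :=
  isGroup.Build isom isom_mulA isom_mul1 isom_mulr1 isom_mulV isom_mulrV.

Definition stabilizer (X : set U) : set isom :=
  [set g | forall x, X x -> g x = x].

Definition double_coset (H K : set isom) (g : isom) : set isom :=
  [set (h * g * k)%g | h in H & k in K].

(* The double coset space H \ isom / K, with its canonical projection. *)
Definition double_cosets (H K : set isom) : Type :=
  set_type (range (double_coset H K)).

Definition double_coset_of (H K : set isom) (g : isom) : double_cosets H K :=
  exist _ (double_coset H K g) (mem_set (imageT (double_coset H K) g)).

End IsometryGroup.

Section Morphisms.
Context (R : realType) (Lambda : set R).

Record triple (X Y : metricType R) := Triple {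
  triple_space : metricType R ;
  triple_pos : X -> triple_space ;
  triple_neg : Y -> triple_space ;
  triple_ultrametric : ultrametric triple_space ;
  triple_spectrum : spectrum triple_space `<=` Lambda ;
  triple_pos_isometric : isometric triple_pos ;
  triple_neg_isometric : isometric triple_neg ;
  triple_cover : range triple_pos `|` range triple_neg = setT
}.

Definition triple_equiv (X Y : metricType R) (m m' : triple X Y) : Prop :=
  exists pi : triple_space m -> triple_space m',
    [/\ bijective pi, isometric pi,
        triple_pos m' = pi \o triple_pos m &
        triple_neg m' = pi \o triple_neg m].

(* The quotient of triple by triple_equiv, as the type of its classes. The
   classes are bare predicates because triple, which contains a metricType,
   lives in a universe too large for set and for the library quotients. *)
Record Mor (X Y : metricType R) := IsMor {
  mor_class : triple X Y -> Prop ;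
  mor_classP : exists m : triple X Y, mor_class = triple_equiv m
}.

Definition mor_of (X Y : metricType R) (m : triple X Y) : Mor X Y :=
  IsMor (ex_intro _ m erefl).

End Morphisms.

Section TripleOfIsometry.
Context (R : realType) (Lambda : set R) (U : metricType R).
Context (HU : is_urysohn Lambda U) (X Y : set U) (g : isom U).

Definition joint_image : set U := Y `|` (g @` X).

Definition joint_pos (x : X) : joint_image :=
  exist _ (g (val x)) (mem_set (or_intror (imageP g (set_mem (valP x))))).

Definition joint_neg (y : Y) : joint_image :=
  exist _ (val y) (mem_set (or_introl (set_mem (valP y)))).

Definition triple_of : triple Lambda (set_type X) (set_type Y).
Proof.
exists (set_type joint_image : metricType R) joint_pos joint_neg.
- by move=> x y z; exact: urysohn_ultrametric HU _ _ _.
- rewrite -(urysohn_spectrum HU) => r [r0 [x [y rE]]].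
  by split => //; exists (val x), (val y).
- by move=> x y; exact: isom_isometric.
- by [].
- rewrite -subTset => -[u uP] _; case: (set_mem uP) => [Yu|[x Xx gxu]].
    by right; exists (exist _ u (mem_set Yu)) => //; exact: val_inj.
  by left; exists (exist _ x (mem_set Xx)) => //; exact: val_inj.
Defined.

End TripleOfIsometry.

(* Main.v *)
(* Everything rests on the homogeneity of U: an isometry between finite subsets
   of U extends to an element of isom U.  Back-and-forth over a countable dense
   set, using the one-point case of the extension property in both directions,
   produces an isometric graph with dense projections; by completeness its
   closure is the graph of a bijective isometry.
   If the triples of g and g' are equivalent through pi, extend pi to an isometry
   h of U: then h fixes Y, h g = g' on X, and g' = h g k with k := (h g)^-1 g'
   fixing X.  Conversely, given a triple (P, p+, p-), extend p-^-1 to an embedding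
   of P into U and extend the resulting embedding of X to an isometry of U. *)
Require Import Defs.
From HB Require Import structures.
From mathcomp Require Import all_boot all_order all_algebra.
From mathcomp Require Import all_classical all_reals topology.
From mathcomp Require Import lra.

Import Order.TTheory GRing.Theory Num.Theory.
Local Open Scope classical_set_scope.
Local Open Scope ring_scope.

(** * Partial isometries as graphs, and their closures *)

(** Partial isometries are encoded as relations so that the two directions of back-and-forth are
    exchanged by a swap. Single-valuedness and injectivity need no separate clause: points at
    distance 0 coincide. *)
Definition isometric_graph {R : realType} {S T : metricType R}
    (G : set (S * T)) : Prop :=
  forall p q, G p -> G q -> mdist p.1 q.1 = mdist p.2 q.2.

Definition swap_graph {S T : Type} (G : set (S * T)) : set (T * S) :=
  [set p | G (p.2, p.1)].

Lemma isometric_graph_swap {R : realType} {S T : metricType R}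
    {G : set (S * T)} :
  isometric_graph G -> isometric_graph (swap_graph G).
Proof. by move=> isoG p q Gp Gq; rewrite -(isoG _ _ Gp Gq). Qed.

Lemma finite_swap_graph {S T : Type} {G : set (S * T)} :
  finite_set G -> finite_set (swap_graph G).
Proof.
move=> finG; apply: sub_finite_set (finite_image (fun p => (p.2, p.1)) finG).
by move=> [a b] Gab; exists (b, a).
Qed.

Lemma finite_subtype {T : choiceType} {A : set T} :
  finite_set A -> finite_set [set: A].
Proof.
move=> finA; apply: (@sub_finite_set _ _ (val @^-1` A)).
  by move=> a _; exact: set_valP.
by apply: finite_preimage finA => a b _ _ /val_inj.
Qed.

Lemma dense_mdist {R : realType} {T : metricType R} {D : set T} (x : T)
    {e : R} :
  dense D -> 0 < e -> exists2 y, D y & mdist x y < e.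
Proof.
move=> dD e0; have [||y [yx Dy]] := dD (interior (ball x e)).
- by exists x; exact: nbhsx_ballx.
- exact: open_interior.
- by exists y => //; move/interior_subset: yx; rewrite ballEmdist.
Qed.

(** This is the topological closure of [G] in the product, written with the distances of the two
    coordinates. *)
Definition graph_closure {R : realType} {S T : metricType R}
    (G : set (S * T)) : set (S * T) :=
  [set q | forall e : R, 0 < e ->
    exists2 p, G p & mdist q.1 p.1 < e /\ mdist q.2 p.2 < e].

Section GraphClosure.
Context {R : realType} {S T : metricType R} {G : set (S * T)}.

Lemma sub_graph_closure : G `<=` graph_closure G.
Proof. by move=> p Gp e e0; exists p => //; rewrite !mdistxx. Qed.

Hypothesis isoG : isometric_graph G.

Lemma isometric_graph_closure : isometric_graph (graph_closure G).
Proof.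
move=> p q Gp Gq.
suff close e : 0 < e -> `|mdist p.1 q.1 - mdist p.2 q.2| < e.
  apply: contrapT => /eqP; rewrite -subr_eq0 -normr_gt0 => /close.
  by rewrite ltxx.
(* Four endpoints each move by less than [e / 4], so each of the two distances changes by less than
   [e / 2]. *)
move=> e0; have e4 : 0 < e / 4 by lra.
have [p' Gp' [p1 p2]] := Gp _ e4; have [q' Gq' [q1 q2]] := Gq _ e4.
have := isoG _ _ Gp' Gq'.
have := metric_triangle p.1 p'.1 q.1; have := metric_triangle p'.1 q'.1 q.1.
have := metric_triangle p.2 p'.2 q.2; have := metric_triangle p'.2 q'.2 q.2.
have := metric_triangle p'.1 p.1 q'.1; have := metric_triangle p.1 q.1 q'.1.
have := metric_triangle p'.2 p.2 q'.2; have := metric_triangle p.2 q.2 q'.2.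
rewrite (metric_sym q'.1 q.1) (metric_sym q'.2 q.2).
rewrite (metric_sym p'.1 p.1) (metric_sym p'.2 p.2) => *.
by rewrite ltr_norml; apply/andP; split; lra.
Qed.

(** The partners of points tending to [x] form a Cauchy filter, because [G] preserves distances; its
    limit is the partner of [x]. *)
Lemma graph_closure_total :
  complete T -> dense (fst @` G) -> forall x, exists y, graph_closure G (x, y).
Proof.
move=> cT dG x.
pose B (e : R) := [set p.2 | p in G `&` [set p | mdist x p.1 < e]].
pose F := filter_from [set e | 0 < e] B.
have FF : ProperFilter F.
  apply: filter_from_proper => [|e e0].
    apply: filter_from_filter => [|e d e0 d0]; first by exists 1; rewrite /= ltr01.
    exists (Num.min e d) => [|y [p [Gp]]]; first by rewrite /= lt_min e0.
    by rewrite /= lt_min => /andP[xe xd] <-; split; exists p.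
  have [_ [p Gp <-] xp] := dense_mdist x dG e0.
  by exists p.2, p.
have cF : cauchy F.
  apply/cauchy_ballP => e e0.
  exists (B (e / 2), B (e / 2)) => /=.
    by split; exists (e / 2) => //=; rewrite divr_gt0.
  move=> [_ _] [/= [p [Gp xp] <-] [q [Gq xq] <-]].
  rewrite ballEmdist /= -(isoG _ _ Gp Gq).
  have := metric_triangle p.1 x q.1; rewrite (metric_sym p.1 x).
  by move: xp xq => /=; lra.
have [y Fy] := cT F FF cF; exists y => e e0.
have [d /= d0 dB] := Fy _ (nbhsx_ballx y e e0).
(* The bound [d] puts [p.2] in the ball of radius [e] around [y]; the bound [e] keeps [p.1] close to
   [x]. *)
have de0 : 0 < Num.min d e by rewrite lt_min d0.
have [_ [p Gp <-]] := dense_mdist x dG de0.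
rewrite lt_min => /andP[xd xe]; exists p => //; split=> //.
by have := dB p.2; rewrite ballEmdist; apply; exists p.
Qed.

End GraphClosure.

Lemma swap_graph_closure {R : realType} {S T : metricType R} (G : set (S * T))
    (p : S * T) :
  graph_closure (swap_graph G) (p.2, p.1) -> graph_closure G p.
Proof. by move=> cGp e /cGp [q Gq [? ?]]; exists (q.2, q.1). Qed.

(** The closure is total in both directions, and preservation of zero distances makes it functional
    and injective; choosing partners on either side gives mutually inverse maps. *)
Lemma isometric_graph_isom {R : realType} {U : metricType R}
    {G : set (U * U)} :
  complete U -> isometric_graph G ->
  dense (fst @` G) -> dense (snd @` G) ->
  exists g : isom U, forall p, G p -> g p.1 = p.2.
Proof.
move=> cU isoG d1 d2.
have isoC := isometric_graph_closure isoG.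
have /choice [f fP] := graph_closure_total isoG cU d1.
have [|f' f'P] := choice (graph_closure_total (isometric_graph_swap isoG) cU _).
  suff -> : fst @` swap_graph G = snd @` G by [].
  apply/seteqP; split=> [_ [p Gp <-]|_ [p Gp <-]]; first by exists (p.2, p.1).
  by exists (p.2, p.1) => //; rewrite /swap_graph /= -surjective_pairing.
have {}f'P y : graph_closure G (f' y, y) by exact: swap_graph_closure.
have eq2 x y z : graph_closure G (x, y) -> graph_closure G (x, z) -> y = z.
  by move=> /isoC /[apply] /= /esym; rewrite mdistxx => /mdist_positivity.
have eq1 x y z : graph_closure G (x, z) -> graph_closure G (y, z) -> x = y.
  by move=> /isoC /[apply] /=; rewrite mdistxx => /mdist_positivity.
have fiso : isometric f by move=> x y; rewrite -(isoC _ _ (fP x) (fP y)).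
have fbij : bijective f.
  by exists f' => x; [exact: eq1 (fP x) | exact: eq2 (f'P x)].
exists (Isom fiso fbij) => -[x y] /sub_graph_closure; exact: eq2 (fP x).
Qed.

(** * Extension of finite partial isometries and homogeneity of [U] *)

Section Urysohn.
Context {R : realType} {Lambda : set R} {U : metricType R}.
Hypothesis HU : is_urysohn Lambda U.

Lemma urysohn_extend_graph {C : metricType R} {G : set (C * U)} :
  finite_set [set: C] -> ultrametric C -> spectrum C `<=` Lambda ->
  isometric_graph G ->
  exists2 h : C -> U, isometric h & forall p, G p -> h p.1 = p.2.
Proof.
move=> finC ultC specC isoG.
have /choice [f fP] (b : fst @` G) : exists u, G (val b, u).
  by have [[c u] Gcu /= <-] := set_valP b; exists u.
have fiso : isometric f by move=> a b; rewrite -(isoG _ _ (fP a) (fP b)).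
have [h hiso hf] := urysohn_extension HU finC ultC specC fiso.
exists h => // -[c u] Gcu /=.
have Bc : (fst @` G) c by exists (c, u).
(* The chosen value [f c] and [u] are both partners of [c], hence at distance 0. *)
rewrite (hf (SigSub (mem_set Bc))); apply/esym/mdist_positivity.
by rewrite -(isoG _ _ Gcu (fP _)) mdistxx.
Qed.

Lemma ultrametric_subspace (A : set U) : ultrametric (A : metricType R).
Proof. by move=> x y z; exact: urysohn_ultrametric HU _ _ _. Qed.

Lemma spectrum_subspace (A : set U) : spectrum (A : metricType R) `<=` Lambda.
Proof.
rewrite -(urysohn_spectrum HU) => r [r0 [x [y rE]]].
by split=> //; exists (val x), (val y).
Qed.

Lemma isometric_graph_extend1 {G : set (U * U)} (x : U) :
  finite_set G -> isometric_graph G ->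
  exists y, isometric_graph ((x, y) |` G).
Proof.
move=> finG isoG; pose A : set U := x |` (fst @` G).
have finA : finite_set A by rewrite finite_setU; split=> //; exact: finite_image.
pose H : set (A * U) := [set q | G (val q.1, q.2)].
have isoH : isometric_graph H by move=> p q Hp Hq; rewrite -(isoG _ _ Hp Hq).
have [h hiso hP] := urysohn_extend_graph (finite_subtype finA)
  (@ultrametric_subspace A) (@spectrum_subspace A) isoH.
have Ax : A x by left.
exists (h (SigSub (mem_set Ax))).
(* The enlarged graph lies inside the graph of [h], from which it inherits being isometric. *)
have hE q : ((x, h (SigSub (mem_set Ax))) |` G) q ->
    exists2 a : A, val a = q.1 & h a = q.2.
  move=> [-> /=|Gq]; first by exists (SigSub (mem_set Ax)).
  have Aq : A q.1 by right; exists q.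
  exists (SigSub (mem_set Aq)) => //.
  by rewrite (hP (SigSub (mem_set Aq), q.2)) // /H /= -surjective_pairing.
by move=> p q /hE[a <- <-] /hE[b <- <-]; rewrite hiso.
Qed.

(** Adding a pair [(x, y)], swapping, adding [(x, z)] and swapping back puts [x] into both
    projections. *)
Lemma back_and_forth {G : set (U * U)} (x : U) :
  finite_set G -> isometric_graph G ->
  exists G', [/\ finite_set G', isometric_graph G', G `<=` G',
                 (fst @` G') x & (snd @` G') x].
Proof.
move=> finG isoG.
have [y isoG1] := isometric_graph_extend1 x finG isoG.
have finG1 : finite_set ((x, y) |` G) by rewrite finite_setU.
have [z isoG2] := isometric_graph_extend1 x (finite_swap_graph finG1)
  (isometric_graph_swap isoG1).
exists (swap_graph ((x, z) |` swap_graph ((x, y) |` G))); split.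
- apply: finite_swap_graph; rewrite finite_setU; split=> //.
  exact: finite_swap_graph.
- exact: isometric_graph_swap.
- by move=> [a b] Gab; right; right.
- by exists (x, y) => //; right; left.
- by exists (z, x) => //; left.
Qed.

Lemma urysohn_homogeneous {G : set (U * U)} :
  finite_set G -> isometric_graph G ->
  exists g : isom U, forall p, G p -> g p.1 = p.2.
Proof.
move=> finG isoG.
have [D /countable_injP [c cinj] dD] := urysohn_separable HU.
pose fin_graph := {H : set (U * U) | finite_set H /\ isometric_graph H}.
(* Stage [n] treats the point of [D] with code [n], unique by injectivity of [c]; if there is none,
   the graph stays as it is. *)
have step (nH : nat * fin_graph) : exists H' : fin_graph,
    sval nH.2 `<=` sval H' /\
    forall x, D x -> c x = nH.1 -> (fst @` sval H') x /\ (snd @` sval H') x.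
  case: nH => n [H [finH isoH]] /=.
  have [[x [Dx cx]]|noD] := pselect (exists x, D x /\ c x = n); last first.
    exists (exist _ H (conj finH isoH)); split=> // x Dx cx.
    by case: noD; exists x.
  have [H' [finH' isoH' subH H'1 H'2]] := back_and_forth x finH isoH.
  exists (exist _ H' (conj finH' isoH')); split=> //= y Dy cy.
  by rewrite (cinj y x) ?inE // cy.
have [next nextP] := choice step.
(* The point [x] of [D] is treated in passing from index [c x] to [(c x).+1]. *)
pose seqG := fix seqG n : fin_graph :=
  if n is m.+1 then next (m, seqG m) else exist _ G (conj finG isoG).
have mono m n : (m <= n)%N -> sval (seqG m) `<=` sval (seqG n).
  elim: n => [|n IHn]; first by rewrite leqn0 => /eqP ->.
  rewrite leq_eqVlt => /predU1P[-> //|/IHn] /subset_trans; apply.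
  exact: (nextP (n, seqG n)).1.
pose Gw := \bigcup_n sval (seqG n).
have isoGw : isometric_graph Gw.
  move=> p q [m _ Gp] [n _ Gq]; apply: (svalP (seqG (maxn m n))).2.
    exact: mono (leq_maxl m n) _ Gp.
  exact: mono (leq_maxr m n) _ Gq.
have denseGw (f : U * U -> U) :
    (forall x, D x -> (f @` sval (seqG (c x).+1)) x) -> dense (f @` Gw).
  move=> fD O O0 oO; have [x [Ox Dx]] := dD O O0 oO.
  by exists x; split=> //; have [p Gp px] := fD x Dx; exists p => //; exists (c x).+1.
have [||g gP] := isometric_graph_isom (urysohn_complete HU) isoGw.
- by apply: denseGw => x Dx; have [] := (nextP (c x, seqG (c x))).2 x Dx erefl.
- by apply: denseGw => x Dx; have [] := (nextP (c x, seqG (c x))).2 x Dx erefl.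
by exists g => p Gp; apply: gP; exists 0%N.
Qed.

Lemma urysohn_homogeneous_on {T : Type} {A : set T} {f h : T -> U} :
  finite_set A ->
  (forall x y, A x -> A y -> mdist (f x) (f y) = mdist (h x) (h y)) ->
  exists g : isom U, forall x, A x -> g (f x) = h x.
Proof.
move=> finA fh.
have [||g gP] := @urysohn_homogeneous [set (f x, h x) | x in A].
- exact: finite_image.
- by move=> _ _ [x Ax <-] [y Ay <-]; exact: fh.
- by exists g => x Ax; apply: (gP (f x, h x)); exists x.
Qed.

End Urysohn.

(** * Equivalence of triples and the quotient [Mor] *)

Section TripleEquiv.
Context {R : realType} {Lambda : set R} {X Y : metricType R}.
Implicit Types m : triple Lambda X Y.

Lemma triple_equiv_refl m : triple_equiv m m.
Proof. by exists id; split=> //; exists id. Qed.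

Lemma triple_equiv_sym {m m'} : triple_equiv m m' -> triple_equiv m' m.
Proof.
move=> [pi [[pi' piK pi'K] piiso posE negE]]; exists pi'; split.
- by exists pi.
- by move=> x y; rewrite -piiso !pi'K.
- by rewrite posE; apply/funext => x /=; rewrite piK.
- by rewrite negE; apply/funext => x /=; rewrite piK.
Qed.

Lemma triple_equiv_trans {m1 m2 m3} :
  triple_equiv m1 m2 -> triple_equiv m2 m3 -> triple_equiv m1 m3.
Proof.
move=> [pi [pibij piiso posE negE]] [rho [rhobij rhoiso posE' negE']].
exists (rho \o pi); split.
- exact: bij_comp.
- by move=> x y /=; rewrite rhoiso piiso.
- by rewrite posE' posE.
- by rewrite negE' negE.
Qed.

Lemma mor_class_inj : injective (@mor_class R Lambda X Y).
Proof.
move=> [c cP] [c' c'P] /= E; rewrite -{}E in c'P *.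
by congr IsMor; exact: Prop_irrelevance.
Qed.

Lemma mor_of_eq m m' : mor_of m = mor_of m' <-> triple_equiv m m'.
Proof.
split=> [/(congr1 (@mor_class _ _ _ _)) /= ->|mm'].
  exact: triple_equiv_refl.
apply: mor_class_inj => /=; apply/predeqP => n; split.
  exact: triple_equiv_trans (triple_equiv_sym mm').
exact: triple_equiv_trans mm'.
Qed.

Lemma mor_of_surj (mu : Mor Lambda X Y) : exists m, mu = mor_of m.
Proof. by case: mu => c [m cE]; exists m; exact: mor_class_inj. Qed.

(** Bijectivity is automatic: an isometric map is injective, and the images of the two legs, which
    [pi] reaches, cover the target. *)
Lemma triple_equivP {m m'} (pi : triple_space m -> triple_space m') :
  isometric pi -> triple_pos m' = pi \o triple_pos m ->
  triple_neg m' = pi \o triple_neg m -> triple_equiv m m'.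
Proof.
move=> piiso posE negE; exists pi; split=> //.
rewrite -setTT_bijective; split=> // [x y _ _ E|z _].
  by apply: mdist_positivity; rewrite -piiso E mdistxx.
have : (range (triple_pos m') `|` range (triple_neg m')) z.
  by rewrite triple_cover.
case=> -[x _ <-]; first by exists (triple_pos m x) => //; rewrite posE.
by exists (triple_neg m x) => //; rewrite negE.
Qed.

End TripleEquiv.

(** * Double cosets against equivalence classes of triples *)

Section DoubleCosets.
Context {R : realType} {Lambda : set R} {U : metricType R}.
Hypothesis HU : is_urysohn Lambda U.
Context {X Y : set U}.
Hypotheses (finX : finite_set X) (finY : finite_set Y).
Implicit Types g h k : isom U.

(** The equivalence is the restriction of [h]: on [X] the factor [k] is invisible, and on [Y] the
    map [h] is the identity. *)
Lemma triple_of_double_coset g h k :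
  stabilizer Y h -> stabilizer X k ->
  triple_equiv (triple_of HU X Y g) (triple_of HU X Y (h * g * k)%g).
Proof.
move=> hY kX.
have hJ (u : joint_image X Y g) : joint_image X Y (h * g * k)%g (h (val u)).
  have [Yu|[x Xx <-]] := set_valP u; first by left; rewrite hY.
  by right; exists x => //=; rewrite (kX x Xx).
apply: (@triple_equivP _ _ _ _ (triple_of HU X Y g)
  (triple_of HU X Y (h * g * k)%g) (fun u => SigSub (mem_set (hJ u)))).
- by move=> x y; exact: isom_isometric h _ _.
- apply/funext => x; apply: val_inj => /=; rewrite kX //; exact: set_valP.
- apply/funext => y; apply: val_inj => /=; rewrite hY //; exact: set_valP.
Qed.

Lemma triple_of_equiv_double_coset g g' :
  triple_equiv (triple_of HU X Y g) (triple_of HU X Y g') ->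
  double_coset (stabilizer Y) (stabilizer X) g g'.
Proof.
move=> [/= pi [_ piiso /= posE negE]].
have [h hP] : exists h, forall u : joint_image X Y g,
    [set: _] u -> h (val u) = val (pi u).
  apply: (urysohn_homogeneous_on HU) => [|u v _ _].
    apply: finite_subtype; rewrite finite_setU; split=> //.
    exact: finite_image.
  exact/esym/piiso.
have hY : stabilizer Y h.
  (* Evaluated at [y], [negE] says that [pi] sends the copy of [y] in one joint image to its copy in
     the other. *)
  move=> y Yy; have := hP (joint_neg X g (SigSub (mem_set Yy))) I.
  by move/(congr1 (fun f => f (SigSub (mem_set Yy)))): negE => /= <-.
have hX x : X x -> h (g x) = g' x.
  move=> Xx; have := hP (joint_pos Y g (SigSub (mem_set Xx))) I.
  by move/(congr1 (fun f => f (SigSub (mem_set Xx)))): posE => /= <-.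
exists h => //; exists ((h * g)^-1 * g')%g; last by rewrite mulgA mulgV mul1g.
by move=> x Xx; rewrite -[RHS](isom_funK (h * g)%g) /= hX.
Qed.

Lemma triple_of_surj (m : triple Lambda X Y) :
  exists g, triple_equiv m (triple_of HU X Y g).
Proof.
(* This is the graph of the inverse of [triple_neg m], followed by the inclusion of [Y] in [U]. *)
pose G : set (triple_space m * U) := range (fun y => (triple_neg m y, val y)).
have isoG : isometric_graph G.
  by move=> _ _ [y _ <-] [z _ <-] /=; rewrite triple_neg_isometric.
have finP : finite_set [set: triple_space m].
  rewrite -(triple_cover m) finite_setU.
  by split; apply: finite_image; exact: finite_subtype.
have [h hiso hG] := urysohn_extend_graph HU finP (@triple_ultrametric _ _ _ _ m)
  (@triple_spectrum _ _ _ _ m) isoG.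
have hY y : h (triple_neg m y) = val y.
  by apply: (hG (triple_neg m y, val y)); exists y.
have [g gP] : exists g, forall x : X, [set: X] x -> g (val x) = h (triple_pos m x).
  apply: (urysohn_homogeneous_on HU) => [|x y _ _]; first exact: finite_subtype.
  by rewrite hiso triple_pos_isometric.
exists g.
have hJ u : joint_image X Y g (h u).
  have : (range (triple_pos m) `|` range (triple_neg m)) u by rewrite triple_cover.
  case=> -[z _ <-]; last by left; rewrite hY; exact: set_valP.
  by right; exists (val z); [exact: set_valP | rewrite gP].
apply: (@triple_equivP _ _ _ _ m (triple_of HU X Y g)
  (fun u => SigSub (mem_set (hJ u)))) => //.
- by apply/funext => x; apply: val_inj => /=; rewrite gP.
- by apply/funext => y; apply: val_inj => /=; rewrite hY.
Qed.

End DoubleCosets.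

Lemma double_coset_of_surj {R : realType} {U : metricType R}
    {H K : set (isom U)} (c : double_cosets H K) :
  exists g, c = double_coset_of H K g.
Proof.
by have [g _ gE] := set_valP c; exists g; apply: val_inj; rewrite -gE.
Qed.

(** Stabilizers are closed under products and inverses, so the factors [h] and [k] relating [g] to
    [g'] can be absorbed on either side. *)
Lemma double_coset_of_mem {R : realType} {U : metricType R} {X Y : set U}
    {g g' : isom U} :
  double_coset (stabilizer Y) (stabilizer X) g g' ->
  double_coset_of (stabilizer Y) (stabilizer X) g =
  double_coset_of (stabilizer Y) (stabilizer X) g'.
Proof.
have stabM (A : set U) (a b : isom U) :
    stabilizer A a -> stabilizer A b -> stabilizer A (a * b)%g.
  by move=> aA bA x Ax /=; rewrite bA ?aA.
have stabV (A : set U) (a : isom U) : stabilizer A a -> stabilizer A a^-1%g.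
  by move=> aA x Ax; rewrite -{1}(aA x Ax); exact: isom_funK.
move=> [h hY [k kX <-]]; apply: val_inj; apply/seteqP; split=> _ [a aY [b bX <-]].
  exists (a * h^-1)%g; first by apply: stabM => //; exact: stabV.
  exists (k^-1 * b)%g; first by apply: stabM => //; exact: stabV.
  by rewrite -!mulgA mulKg mulVKg.
by exists (a * h)%g; [exact: stabM | exists (k * b)%g; [exact: stabM | rewrite !mulgA]].
Qed.

(** * The bijection between double cosets and morphisms *)

Theorem lemma4p2 (R : realType) (Lambda : set R)
  (Lambda_gt0 : Lambda `<=` [set r | 0 < r]) (Lambda_countable : countable Lambda)
  (U : metricType R) (HU : is_urysohn Lambda U)
  (X Y : set U) (X0 : X !=set0) (Y0 : Y !=set0)
  (finX : finite_set X) (finY : finite_set Y) :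
  exists Phi : double_cosets (stabilizer Y) (stabilizer X) ->
               Mor Lambda (set_type X) (set_type Y),
    bijective Phi /\
    forall g : isom U,
      Phi (double_coset_of (stabilizer Y) (stabilizer X) g) =
      mor_of (triple_of HU X Y g).
Proof.
have [rep repP] := choice (@double_coset_of_surj _ _ (stabilizer Y) (stabilizer X)).
pose Phi c := mor_of (triple_of HU X Y (rep c)).
have PhiE g : Phi (double_coset_of _ _ g) = mor_of (triple_of HU X Y g).
  have mem1 : double_coset (stabilizer Y) (stabilizer X) g g.
    by exists 1%g => //; exists 1%g => //; rewrite mul1g mulg1.
  (* The representative need not be [g], but [g] lies in its double coset, which yields factors [h]
     and [k] carrying the representative to [g]. *)
  have := congr1 val (repP (double_coset_of _ _ g)) => /= E.
  rewrite E in mem1; have [h hY [k kX gE]] := mem1.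
  apply/mor_of_eq; rewrite -[in X in triple_equiv _ X]gE.
  exact: triple_of_double_coset.
have Phi_inj c c' : Phi c = Phi c' -> c = c'.
  move=> /mor_of_eq /(triple_of_equiv_double_coset HU finX finY) cc'.
  by rewrite (repP c) (repP c'); exact: double_coset_of_mem.
have Phi_surj mu : exists c, Phi c = mu.
  have [m ->] := mor_of_surj mu.
  have [g mg] := triple_of_surj HU finX finY m.
  exists (double_coset_of _ _ g).
  by rewrite PhiE; apply/mor_of_eq; exact: triple_equiv_sym.
exists Phi; split=> //.
(* [Mor] lies in too large a universe for [setTT_bijective] and [choice]. *)
exists (fun mu => sval (cid (Phi_surj mu))) => [c|mu]; last by case: cid.
by apply: Phi_inj; case: cid.
Qed.
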